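(* Let $K,F,S$ be positive integers. There exists a $(K,F,S)$ PDA with $n$ integer entries if and only if there exists a set $\mathcal{C}\subseteq[0,F)\times[0,K)\times[0,S)$ with cardinality $n$ satisfying: P1: the minimum Hamming distance of $\mathcal{C}$ is at least $2$, i.e. any two distinct elements of $\mathcal{C}$ differ in at least two coordinates; and P2: there are no $i_1\neq i_2$ in $[0,F)$, $j_1\neq j_2$ in $[0,K)$ and $a\neq b$ in $[0,S)$ such that the three vectors $(i_1,j_1,a)$, $(i_1,j_2,b)$, $(i_2,j_2,a)$ all belong to $\mathcal{C}$.
   Context: Write $[0,b)=\{0,1,\ldots,b-1\}$. For positive integers $K,F$, a $(K,F,S)$ placement delivery array (PDA) is an $F\times K$ array $\mathbf{P}=(p_{i,j})$, $i\in[0,F)$, $j\in[0,K)$, each of whose entries is either the symbol $*$ (''star'') or an integer from $[0,S)$ (it is not required that every integer of $[0,S)$ occurs), such that: whenever two distinct entries satisfy $p_{i_1,j_1}=p_{i_2,j_2}=s$ with $s$ an integer, then (a) $i_1\neq i_2$ and $j_1\neq j_2$, and (b) $p_{i_1,j_2}=p_{i_2,j_1}=*$. An integer entry is an entry that is not a star. *)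

(* Defs.v *)
From mathcomp Require Import all_boot all_algebra.
Set Implicit Arguments.
Unset Strict Implicit.
Unset Printing Implicit Defensive.

(* An F x K array over {star} u [0,S) is a matrix over [option 'I_S]:
   [None] is the star and [Some s] is the integer s. *)
Notation star := None (only parsing).

Definition pda_array (K F S : nat) := 'M[option 'I_S]_(F, K).

(* "Two distinct entries" means entries at two distinct positions. *)
Definition is_PDA (K F S : nat) (P : pda_array K F S) : Prop :=
  forall (i1 i2 : 'I_F) (j1 j2 : 'I_K) (s : 'I_S),
    (i1, j1) <> (i2, j2) -> P i1 j1 = Some s -> P i2 j2 = Some s ->
    (i1 <> i2 /\ j1 <> j2) /\ (P i1 j2 = star /\ P i2 j1 = star).

Definition integer_entries (K F S : nat) (P : pda_array K F S) :
    {set 'I_F * 'I_K} :=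
  [set ij | P ij.1 ij.2 != star].

Definition hamming_distance (F K S : nat) (x y : 'I_F * 'I_K * 'I_S) : nat :=
  (x.1.1 != y.1.1) + (x.1.2 != y.1.2) + (x.2 != y.2).

(* Stated pairwise, so that it holds vacuously for codes with fewer than two
   codewords, where the minimum ranges over the empty set. *)
Definition min_distance_ge (F K S : nat) (C : {set 'I_F * 'I_K * 'I_S})
    (d : nat) : Prop :=
  forall x y, x \in C -> y \in C -> x <> y -> d <= hamming_distance x y.

(* Main.v *)
Require Import Defs.
From mathcomp Require Import all_boot all_algebra.
Set Implicit Arguments.
Unset Strict Implicit.
Unset Printing Implicit Defensive.

(** Identify an array with the graph of its integer part, the set of triples
    (i, j, s) with [P i j = s]. Distance at least 2 makes a code the graph of
    a partial function of (i, j) and also gives condition (a) of a PDA;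
    condition P2 is condition (b). *)

Definition pda_code (K F S : nat) (P : pda_array K F S) :
    {set 'I_F * 'I_K * 'I_S} :=
  [set x | P x.1.1 x.1.2 == Some x.2].

Definition P2_configuration (K F S : nat) (C : {set 'I_F * 'I_K * 'I_S}) :
    Prop :=
  exists (i1 i2 : 'I_F) (j1 j2 : 'I_K) (a b : 'I_S),
    [/\ i1 <> i2, j1 <> j2 & a <> b] /\
    [/\ (i1, j1, a) \in C, (i1, j2, b) \in C & (i2, j2, a) \in C].

Lemma mem_pda_code (K F S : nat) (P : pda_array K F S) i j s :
  ((i, j, s) \in pda_code P) = (P i j == Some s).
Proof. by rewrite inE. Qed.

(** Projecting a triple to its cell is injective on the code, since the entry of [P] there
    determines the integer. *)
Lemma card_pda_code (K F S : nat) (P : pda_array K F S) :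
  #|pda_code P| = #|integer_entries P|.
Proof.
have -> : integer_entries P = [set x.1 | x in pda_code P].
  apply/setP=> -[i j]; rewrite inE /=; apply/idP/imsetP.
    by case E: (P i j) => [s|] // _; exists (i, j, s); rewrite // mem_pda_code E.
  by case=> -[[i' j'] s] /[!mem_pda_code] /eqP E [-> ->]; rewrite E.
rewrite card_in_imset // => -[[i j] s] [[i' j'] s'].
rewrite !mem_pda_code /= => /eqP E /eqP E' [ei ej].
by move: E'; rewrite -ei -ej E => -[->].
Qed.

Lemma is_PDA_pda_code (K F S : nat) (P : pda_array K F S) :
  is_PDA P <-> min_distance_ge (pda_code P) 2 /\ ~ P2_configuration (pda_code P).
Proof.
split=> [PDA | [dist noP2]].
  split.
    move=> [[i j] s] [[i' j'] s'].
    rewrite !mem_pda_code /hamming_distance /= => /eqP E /eqP E' neq.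
    have neq_ij : (i, j) <> (i', j').
      by move=> [ei ej]; apply: neq; move: E'; rewrite -ei -ej E => -[->].
    (* Different integers add one to what the distinct cells contribute; equal integers need both
       row and column to differ, which is condition (a). *)
    have [es | _] := eqVneq s s'; last first.
      by case: (eqVneq i i') neq_ij => [->|]; case: (eqVneq j j') => [->|].
    rewrite -es in E'.
    by have [[/eqP -> /eqP ->] _] := PDA _ _ _ _ _ neq_ij E E'.
  move=> [i1 [i2 [j1 [j2 [a [b [[ni nj _]]]]]]]].
  rewrite !mem_pda_code => -[/eqP E1 /eqP Eb /eqP E2].
  have neq : (i1, j1) <> (i2, j2) by case.
  (* The integer [b] sits in a cell that condition (b) forces to be a star. *)
  by have [_ []] := PDA _ _ _ _ _ neq E1 E2; rewrite Eb.
(* With equal third coordinates, distance 2 can only come from both the row and the column. *)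
have separated i1 j1 i2 j2 s : P i1 j1 = Some s -> P i2 j2 = Some s ->
    (i1, j1) <> (i2, j2) -> i1 <> i2 /\ j1 <> j2.
  move=> E1 E2 neq.
  have : 2 <= hamming_distance (i1, j1, s) (i2, j2, s).
    by apply: dist; rewrite ?mem_pda_code ?E1 ?E2 // => -[ei ej];
       case: neq; rewrite ei ej.
  rewrite /hamming_distance /= eqxx.
  by case: (eqVneq i1 i2) => [_ | /eqP ni]; case: (eqVneq j1 j2) => [_ | /eqP nj].
have cross i1 j1 i2 j2 s : P i1 j1 = Some s -> P i2 j2 = Some s ->
    i1 <> i2 -> j1 <> j2 -> P i1 j2 = None.
  move=> E1 E2 ni nj; case Eb: (P i1 j2) => [b|] //; case: noP2.
  exists i1, i2, j1, j2, s, b; rewrite !mem_pda_code E1 E2 Eb !eqxx.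
  (* It remains that [b] differs from [s]: otherwise [s] would occur twice in row [i1], against
     [separated]. *)
  split; split=> // sb; move: Eb; rewrite -sb => Eb.
  by have [] := separated _ _ _ _ _ E1 Eb (fun e => nj (congr1 snd e)).
move=> i1 i2 j1 j2 s neq E1 E2.
have [ni nj] := separated _ _ _ _ _ E1 E2 neq.
split=> //; split; first exact: cross E1 E2 ni nj.
(* The second star follows by exchanging the two cells. *)
exact: cross E2 E1 (nesym ni) (nesym nj).
Qed.

(** Two triples of [C] over one cell would be at distance 1, so [pick] finds the only candidate;
    over a cell with no triple it returns [None], the star. *)
Lemma pda_code_surj (K F S : nat) (C : {set 'I_F * 'I_K * 'I_S}) :
  min_distance_ge C 2 -> exists P : pda_array K F S, pda_code P = C.
Proof.
move=> dist; exists (\matrix_(i, j) [pick s | (i, j, s) \in C])%R.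
apply/setP=> -[[i j] s]; rewrite mem_pda_code mxE.
case: pickP => [t tC | -> //]; apply/eqP/idP => [[<-] // | sC].
have [-> // | nts] := eqVneq t s.
have : (i, j, t) <> (i, j, s) by case; apply/eqP.
by move=> /(dist _ _ tC sC); rewrite /hamming_distance /= !eqxx nts.
Qed.

Theorem theorem6 (K F S n : nat) (K_gt0 : 0 < K) (F_gt0 : 0 < F)
    (S_gt0 : 0 < S) :
  (exists P : pda_array K F S, is_PDA P /\ #|integer_entries P| = n)
  <->
  (exists C : {set 'I_F * 'I_K * 'I_S},
    [/\ #|C| = n,
        min_distance_ge C 2
      & ~ (exists (i1 i2 : 'I_F) (j1 j2 : 'I_K) (a b : 'I_S),
             [/\ i1 <> i2, j1 <> j2 & a <> b] /\
             [/\ (i1, j1, a) \in C, (i1, j2, b) \in C & (i2, j2, a) \in C])]).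
Proof.
split=> [[P [/is_PDA_pda_code [dist noP2] cardP]] | [C [cardC dist noP2]]].
  by exists (pda_code P); rewrite card_pda_code.
have [P defC] := pda_code_surj dist.
by exists P; split; [apply/is_PDA_pda_code; rewrite defC | rewrite -card_pda_code defC].
Qed.
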